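(* Let $s>0$ be a real number and let $\gamma:\widehat{G}\to(0,\infty)$ be a measurable function. If $(1+\gamma(\cdot)^2)^{-\frac{s}{2}}\in L^2(\widehat{G})$, then $\mathfrak{H}^s_\gamma(G,H)\hookrightarrow\mathcal{B}(H)$ (continuous embedding), and for all $T\in\mathfrak{H}^s_\gamma(G,H)$, $$\|T\|_{op}\le\left\|(1+\gamma(\cdot)^2)^{-\frac{s}{2}}\right\|_{L^2(\widehat{G})}\|T\|_{\mathfrak{H}^s_\gamma(G,H)}.$$
   Context: Setting. $G$ is a locally compact abelian Hausdorff group with neutral element $e$ and Pontryagin dual $\widehat{G}$; $H$ is a separable complex Hilbert space. $U:G\to U(H)$, $x\mapsto U_x$, is a (strongly continuous) irreducible unitary projective representation of $G$ on $H$: $U_xU_y=m(x,y)U_{xy}$ for all $x,y\in G$, with multiplier $m:G\times G\to\mathbb{T}$ (the unit circle), and $U_e=I$. Put $\sigma(x,y)=m(x,y)/m(y,x)$, so that $U_xU_y=\sigma(x,y)U_yU_x$. It is assumed that: $m$ is a Heisenberg multiplier, i.e. $x\mapsto\sigma(x,\cdot)$ is a topological isomorphism from $G$ onto $\widehat{G}$; $m(x,y)=m(x^{-1},y^{-1})$ for all $x,y\in G$; $U$ is square integrable, i.e. there are non-zero $\phi,\psi\in H$ with $x\mapsto\langle U_x\phi,\psi\rangle$ in $L^2(G)$; and $U$ is integrable, i.e. there is a non-zero $\psi\in H$ with $x\mapsto\langle U_x\psi,\psi\rangle$ in $L^1(G)$. One identifies $\widehat{G}$ with $G$ through $\sigma$: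 for $\xi=\sigma(x,\cdot)\in\widehat{G}$ one writes $U_\xi:=U_x$. Operator spaces. $\mathcal{B}(H)$ is the space of bounded linear operators on $H$ with operator norm $\|\cdot\|_{op}$. For $1\le p<\infty$, $S_p(H)$ is the space of compact operators on $H$ whose singular values are $p$-summable, with norm $\|T\|_{S_p(H)}$ equal to the $\ell^p$ norm of the singular values. $S_1(H)$ is the trace class and $S_2(H)$ the Hilbert-Schmidt class. Quantum Fourier transform. For $T\in S_1(H)$, $\mathcal{F}_U(T)(\xi)=\mathrm{tr}(TU_\xi^* )$, $\xi\in\widehat{G}$. The Haar measure $d\xi$ on $\widehat{G}$ is normalized so that the (known) Plancherel theorem holds: $\mathcal{F}_U$ extends (uniquely) from $S_1(H)$ to a unitary operator $\mathcal{F}_U:S_2(H)\to L^2(\widehat{G})$. This extension defines $\mathcal{F}_U$ on $S_2(H)$. Quantum Sobolev space. For $s>0$, $$\mathfrak{H}^s_\gamma(G,H)=\left\{T\in S_2(H) : \int_{\widehat{G}}(1+\gamma(\xi)^2)^s|\mathcal{F}_U(T)(\xi)|^2\,d\xi<\infty\right\},\quad \|T\|_{\mathfrak{H}^s_\gamma(G,H)}=\left(\int_{\widehat{G}}(1+\gamma(\xi)^2)^s|\mathcal{F}_U(T)(\xi)|^2\,d\xi\right)^{1/2}.$$ Embeddings. For Banach spaces $X,Y$, $X\hookrightarrow Y$ means $X\subset Y$ and there is a constant $C>0$ with $\|x\|_Y\le C\|x\|_X$ for all $x\in X$. *)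

(* Defs.v *)
From HB Require Import structures.
From mathcomp Require Import all_boot all_order all_algebra.
From mathcomp Require Import complex.
From mathcomp Require Import all_classical all_reals all_analysis.

Set Implicit Arguments.
Unset Strict Implicit.
Unset Printing Implicit Defensive.
Import Order.TTheory GRing.Theory Num.Theory.
Import numFieldNormedType.Exports.
Local Open Scope classical_set_scope.
Local Open Scope ring_scope.
Local Open Scope complex_scope.

(* The library puts the norm topology on [K^o] for an abstract numFieldType K;
   here it is transported to the concrete field of complex numbers. *)
HB.instance Definition _ (R : rcfType) := NormedModule.copy R[i] R[i]^o.

(* On a normed space over R[i] the norm takes values in R[i]. *)
Definition rnorm (R : rcfType) (V : normedModType R[i]) (x : V) : R :=
  complex.Re `|x|.

HB.mixin Record NormedModule_hasInner (R : realType) H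
    & NormedModule R[i] H := {
  inner : {dot H for (@Num.conj R[i])} ;
  inner_norm : forall x : H, `|x| ^+ 2 = inner x x
}.

#[short(type="hilbertType")]
HB.structure Definition Hilbert (R : realType) :=
  {H of CompleteNormedModule R[i] H & NormedModule_hasInner R H}.

Section Operators.
Variables (R : realType) (H : hilbertType R).
Implicit Types (T S : H -> H) (e : nat -> H).

Definition bounded_op : set (H -> H) :=
  [set T | linear T /\ exists M : R, forall x, rnorm (T x) <= M * rnorm x].

Definition opnorm T : \bar R :=
  ereal_sup [set (rnorm (T x))%:E | x in [set x | rnorm x <= 1]].

Definition unitary_op T : Prop :=
  [/\ linear T, (forall x y, inner (T x) (T y) = inner x y) &
      forall y, exists x, T x = y].

Definition compact_op : set (H -> H) :=
  [set T | bounded_op T /\ precompact (T @` [set x | rnorm x <= 1])].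

Definition adjoint T : H -> H :=
  xget (fun=> 0) [set S | bounded_op S /\
                          forall x y, inner (T x) y = inner x (S y)].

Definition lin_indep n (v : 'I_n -> H) : Prop :=
  forall a : 'I_n -> R[i], \sum_i a i *: v i = 0 -> forall i, a i = 0.

Definition subspace_dim (E : set H) : \bar R :=
  ereal_sup [set n%:R%:E | n in
    [set n | exists v : 'I_n -> H, (forall i, E (v i)) /\ lin_indep v]].

(* s > 0 is a singular value of T when s^2 is an eigenvalue of T^* T; its
   multiplicity is the dimension of the eigenspace. *)
Definition sing_mult T (s : R) : \bar R :=
  subspace_dim [set x | adjoint T (T x) = (s ^+ 2)%:C *: x].

Definition schatten_norm (p : R) T : \bar R :=
  ((\esum_(s in [set s : R | (0 < s)%R]) (sing_mult T s * (s `^ p)%R%:E)) `^ p^-1)%E.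

Definition schatten (p : R) : set (H -> H) :=
  [set T | compact_op T /\ (schatten_norm p T < +oo)%E].

(* A sequence so that finite-dimensional spaces are covered too: terms may be
   zero, and the nonzero ones form an orthonormal basis. *)
Definition orthonormal_basis e : Prop :=
  [/\ (forall i, e i = 0 \/ rnorm (e i) = 1),
      (forall i j, i <> j -> inner (e i) (e j) = 0) &
      (forall x, (forall i, inner x (e i) = 0) -> x = 0)].

(* Meaningful on the trace class, where the sum exists and does not depend on
   the basis. *)
Definition trace T : R[i] :=
  xget 0 [set t : R[i] | forall e, orthonormal_basis e ->
    (fun n => \sum_(k < n) inner (T (e k)) (e k)) @ \oo --> t].

Definition hs_inner T S : R[i] := trace (T \o adjoint S).

End Operators.

Section ComplexFunctions.
Context d (X : measurableType d) (R : realType) (mu : {measure set X -> \bar R}).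
Implicit Types f g : X -> R[i].

Definition cmeasurable f : Prop :=
  measurable_fun setT (fun x => complex.Re (f x)) /\
  measurable_fun setT (fun x => complex.Im (f x)).

Definition cLp (p : R) : set (X -> R[i]) :=
  [set f | cmeasurable f /\ (\int[mu]_x (rnorm (f x) `^ p)%R%:E < +oo)%E].

Definition cintegral f : R[i] :=
  (\int[mu]_x complex.Re (f x)) +i* (\int[mu]_x complex.Im (f x)).

Definition L2_inner f g : R[i] := cintegral (fun x => f x * (g x)^*%C).

End ComplexFunctions.

(* Abelian groups are written additively, the dual group included: the sum of
   two characters is their pointwise product. *)
Record dual (R : realType) (G : topologicalZmodType) := Dual {
  character :> G -> R[i] ;
  character_continuous : continuous character ;
  character_norm : forall x, `|character x| = 1 ;
  characterD : forall x y, character (x + y) = character x * character y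
}.

Section DualGroup.
Variables (R : realType) (G : topologicalZmodType).
Local Notation D := (dual R G).
Implicit Types chi psi : D.

Lemma dual_ext chi psi : (forall x, chi x = psi x) -> chi = psi.
Proof.
case: chi psi => f fc fn fD [g gc gn gD] /= /funext fg.
move: fc fn fD; rewrite fg => fc fn fD.
by congr Dual; exact: Prop_irrelevance.
Qed.

HB.instance Definition _ := gen_eqMixin D.
HB.instance Definition _ := gen_choiceMixin D.

Lemma dual_one_continuous : continuous (fun _ : G => 1 : R[i]).
Proof. by move=> x; exact: cvg_cst. Qed.

Definition dual_zero : D :=
  @Dual R G (fun=> 1) dual_one_continuous (fun=> normr1 _)
    (fun _ _ => esym (mulr1 1)).

Lemma dual_mul_continuous chi psi : continuous (fun x => chi x * psi x).
Proof.
by move=> x; apply: (@cvgM R[i]); exact: character_continuous.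
Qed.

Lemma dual_mul_norm chi psi x : `|chi x * psi x| = 1.
Proof. by rewrite normrM !character_norm mulr1. Qed.

Lemma dual_mulD chi psi x y :
  chi (x + y) * psi (x + y) = chi x * psi x * (chi y * psi y).
Proof. by rewrite !characterD mulrACA. Qed.

Definition dual_add chi psi : D :=
  Dual (@dual_mul_continuous chi psi) (dual_mul_norm chi psi)
    (dual_mulD chi psi).

Lemma character_neq0 chi x : chi x != 0.
Proof. by rewrite -normr_gt0 character_norm ltr01. Qed.

Lemma dual_inv_continuous chi : continuous (fun x => (chi x)^-1).
Proof.
move=> x; apply: (@cvgV R[i]) => //; first exact: character_neq0.
exact: character_continuous.
Qed.

Lemma dual_inv_norm chi x : `|(chi x)^-1| = 1.
Proof. by rewrite normfV character_norm invr1. Qed.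

Lemma dual_invD chi x y : (chi (x + y))^-1 = (chi x)^-1 * (chi y)^-1.
Proof. by rewrite characterD invfM. Qed.

Definition dual_opp chi : D :=
  Dual (@dual_inv_continuous chi) (dual_inv_norm chi) (dual_invD chi).

Lemma dual_addA : associative dual_add.
Proof. by move=> a b c; apply: dual_ext => x /=; rewrite mulrA. Qed.

Lemma dual_addC : commutative dual_add.
Proof. by move=> a b; apply: dual_ext => x /=; rewrite mulrC. Qed.

Lemma dual_add0 : left_id dual_zero dual_add.
Proof. by move=> a; apply: dual_ext => x /=; rewrite mul1r. Qed.

Lemma dual_addN : left_inverse dual_zero dual_opp dual_add.
Proof.
by move=> a; apply: dual_ext => x /=; rewrite mulVf// character_neq0.
Qed.

HB.instance Definition _ :=
  GRing.isZmodule.Build D dual_addA dual_addC dual_add0 dual_addN.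

HB.instance Definition _ := Topological.copy D
  (@initial_topology D {compact-open, G -> R[i]} (@character R G)).

End DualGroup.

Definition borel (T : PreTopologicalZmodule.type) : Type := T.

HB.instance Definition _ (T : PreTopologicalZmodule.type) :=
  PreTopologicalZmodule.copy (borel T) T.
HB.instance Definition _ (T : PreTopologicalZmodule.type) :=
  isPointed.Build (borel T) 0.
HB.instance Definition _ (T : PreTopologicalZmodule.type) :=
  Measurable.copy (borel T) (g_sigma_algebraType (@open (borel T))).

Definition haar_measure (R : realType) (T : PreTopologicalZmodule.type)
    (mu : {measure set (borel T) -> \bar R}) : Prop :=
  [/\ mu setT <> 0%E,
      (forall (x : borel T) A, measurable A -> mu [set x + y | y in A] = mu A),
      (forall K, compact K -> (mu K < +oo)%E),
      (forall A, measurable A ->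
        mu A = ereal_inf [set mu O | O in [set O | open O /\ A `<=` O]]) &
      (forall O, open O ->
        mu O = ereal_sup [set mu K | K in [set K | compact K /\ K `<=` O]])].

Definition separable_space (T : topologicalType) : Prop :=
  exists2 D : set T, countable D & dense D.

Section ProjectiveRepresentations.
Variables (R : realType) (G : topologicalZmodType) (H : hilbertType R).
Implicit Types (m : G -> G -> R[i]) (U : G -> H -> H).

Definition projective_rep m U : Prop :=
  [/\ (forall x, unitary_op (U x)),
      (forall v, continuous (fun x => U x v)),
      (forall x y, `|m x y| = 1),
      (forall x y v, U x (U y v) = m x y *: U (x + y) v) &
      (forall v, U 0 v = v)].

Definition irreducible U : Prop :=
  (exists v : H, v <> 0) /\
  forall V : set H, closed V -> V 0 ->
    (forall (a : R[i]) u v, V u -> V v -> V (a *: u + v)) ->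
    (forall x v, V v -> V (U x v)) ->
    V = [set 0] \/ V = setT.

Definition topological_iso (A B : PreTopologicalZmodule.type)
    (f : A -> B) (g : B -> A) : Prop :=
  [/\ {morph f : x y / x + y}, cancel f g, cancel g f, continuous f &
      continuous g].

(* sigma is x |-> m(x, .) / m(., x), a map from G onto its dual, and sigmaV is
   its inverse. *)
Definition heisenberg_multiplier m (sigma : G -> dual R G)
    (sigmaV : dual R G -> G) : Prop :=
  (forall x y, sigma x y = m x y / m y x) /\ topological_iso sigma sigmaV.

Definition square_integrable (lambda : {measure set (borel G) -> \bar R}) U :=
  exists phi psi : H, [/\ phi <> 0, psi <> 0 &
    cLp lambda 2 (fun x => inner (U x phi) psi)].

Definition integrable_rep (lambda : {measure set (borel G) -> \bar R}) U :=
  exists psi : H, psi <> 0 /\ cLp lambda 1 (fun x => inner (U x psi) psi).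

Definition fourier_S1 U (sigmaV : dual R G -> G) (T : H -> H)
    (xi : borel (dual R G)) : R[i] :=
  trace (T \o adjoint (U (sigmaV xi))).

(* F is the extension of the Fourier transform of trace class operators to a
   unitary operator from S_2(H) onto L^2(mu), each class in L^2(mu) being given
   by a representative. Since S_1(H) is dense in S_2(H), F is unique up to
   mu-a.e. equality of F T, for each T. That such an F exists is what fixes the
   scaling of the Haar measure mu. *)
Definition quantum_fourier (mu : {measure set (borel (dual R G)) -> \bar R})
    U (sigmaV : dual R G -> G) (F : (H -> H) -> borel (dual R G) -> R[i]) : Prop :=
  [/\ (forall T, schatten 2 T -> cLp mu 2 (F T)),
      (forall (a : R[i]) T S, schatten 2 T -> schatten 2 S ->
        {ae mu, forall xi, F (fun v => a *: T v + S v) xi = a * F T xi + F S xi}),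
      (forall T S, schatten 2 T -> schatten 2 S ->
        L2_inner mu (F T) (F S) = hs_inner T S),
      (forall f, cLp mu 2 f ->
        exists2 T, schatten 2 T & {ae mu, forall xi, F T xi = f xi}) &
      (forall T, schatten 1 T ->
        {ae mu, forall xi, F T xi = fourier_S1 U sigmaV T xi})].

Section Sobolev.
Variables (mu : {measure set (borel (dual R G)) -> \bar R}).
Variables (F : (H -> H) -> borel (dual R G) -> R[i]).
Variables (s : R) (gamma : borel (dual R G) -> R).

Definition sobolev_integral (T : H -> H) : \bar R :=
  (\int[mu]_xi ((1 + gamma xi ^+ 2) `^ s * rnorm (F T xi) ^+ 2)%R%:E)%E.

Definition qsobolev : set (H -> H) :=
  [set T | schatten 2 T /\ (sobolev_integral T < +oo)%E].

Definition qsobolev_norm (T : H -> H) : \bar R :=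
  (sobolev_integral T `^ 2^-1)%E.

End Sobolev.
End ProjectiveRepresentations.

Definition embeds (V : Type) (R : realType) (X : set V) (normX : V -> \bar R)
    (Y : set V) (normY : V -> \bar R) : Prop :=
  X `<=` Y /\
  exists2 C : R, 0 < C & forall x, X x -> (normY x <= C%:E * normX x)%E.

(* Main.v *)
Require Import Defs.
From mathcomp Require Import all_boot all_order all_algebra.
From mathcomp Require Import complex.
From mathcomp Require Import all_classical all_reals all_analysis.
From mathcomp Require Import measurable_realfun ring.

Set Implicit Arguments.
Unset Strict Implicit.
Unset Printing Implicit Defensive.
Import Order.TTheory GRing.Theory Num.Theory.
Import numFieldNormedType.Exports.
Local Open Scope classical_set_scope.
Local Open Scope ring_scope.
Local Open Scope complex_scope.

(* For x in H let S = <., x> T x, of rank one.  By Parseval, the Hilbert-Schmidt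
   product of T and S is <T x, T x>, while F S (xi) = tr (S U_xi^* ), which is
   <T x, U_xi x>, is bounded by |x| |T x|, U_xi being unitary.  Plancherel then
   gives |T x|^2 <= |x| |T x| int |F T|, i.e. opnorm T <= int |F T|, and
   Cauchy-Schwarz with weight 1 + gamma^2 bounds the last integral.
   The choice of T x as second vector makes the Hilbert-Schmidt product real, so
   that no triangle inequality for complex integrals is needed. *)

(** * The real-valued norm *)

Section RealNorm.
Variables (R : realType) (V : normedModType R[i]).
Implicit Types x y : V.

Lemma rnormE x : (rnorm x)%:C = `|x|.
Proof. by rewrite RRe_real// ger0_real. Qed.

Lemma rnorm_ge0 x : 0 <= rnorm x.
Proof. by rewrite -ler0c rnormE. Qed.

Lemma rnormZ (a : R[i]) x : rnorm (a *: x) = rnorm a * rnorm x.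
Proof.
by apply: complexI; rewrite rnormE normrZ rmorphM /= !rnormE.
Qed.

End RealNorm.

Lemma rnorm_complexE (R : realType) (z : R[i]) :
  rnorm z = Num.sqrt (complex.Re z ^+ 2 + complex.Im z ^+ 2).
Proof. by rewrite /rnorm normc_def. Qed.

Lemma rnorm_ge_Re (R : realType) (z : R[i]) : `|complex.Re z| <= rnorm z.
Proof. by rewrite -lecR rnormE; exact: normc_ge_Re. Qed.

Lemma rnorm_ge_Im (R : realType) (z : R[i]) : `|complex.Im z| <= rnorm z.
Proof.
by rewrite rnorm_complexE -sqrtr_sqr ler_wsqrtr// lerDr sqr_ge0.
Qed.

(** * Inner products: Cauchy-Schwarz and continuity *)

Section InnerProduct.
Variables (R : realType) (H : hilbertType R).
Implicit Types (x y z : H) (a : R[i]).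

Lemma innerZl a x y : inner (a *: x) y = a * inner x y.
Proof. exact: linearZl_LR. Qed.

Lemma innerZr a x y : inner x (a *: y) = Num.conj a * inner x y.
Proof. exact: linearZr_LR. Qed.

Lemma innerC x y : inner x y = Num.conj (inner y x).
Proof. by rewrite hermC mul1r. Qed.

Lemma inner_ge0 x : 0 <= inner x x.
Proof. by rewrite -inner_norm exprn_ge0. Qed.

Lemma inner_eq0 x : inner x x = 0 -> x = 0.
Proof.
by rewrite -inner_norm => /eqP; rewrite expf_eq0 /= normr_eq0 => /eqP.
Qed.

Lemma innerDl x y z : inner (x + y) z = inner x z + inner y z.
Proof. exact: linearDl. Qed.

Lemma innerBl x y z : inner (x - y) z = inner x z - inner y z.
Proof. exact: linearBl. Qed.

Lemma innerBr x y z : inner x (y - z) = inner x y - inner x z.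
Proof. exact: linearBr. Qed.

Lemma inner0l x : inner 0 x = 0.
Proof. exact: linear0l. Qed.

Lemma inner0r x : inner x 0 = 0.
Proof. exact: linear0r. Qed.

Lemma inner_suml (I : Type) (r : seq I) (P : pred I) (f : I -> H) y :
  inner (\sum_(i <- r | P i) f i) y = \sum_(i <- r | P i) inner (f i) y.
Proof. exact: linear_sumlz. Qed.

Lemma inner_sumr (I : Type) (r : seq I) (P : pred I) (f : I -> H) y :
  inner y (\sum_(i <- r | P i) f i) = \sum_(i <- r | P i) inner y (f i).
Proof. exact: linear_sumr. Qed.

Lemma inner_cauchy_schwarz x y : `|inner x y| <= `|x| * `|y|.
Proof.
have [->|y0] := eqVneq y 0; first by rewrite inner0r !normr0 mulr0.
have ny0 : 0 < `|y| by rewrite normr_gt0.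
rewrite -(@ler_pXn2r _ 2) ?nnegrE ?mulr_ge0// exprMn.
(* [a *: y] is the projection of [x] on the line through [y]; the inequality is the positivity of
   the squared norm of [x - a *: y]. *)
pose a := inner x y / `|y| ^+ 2.
have := inner_ge0 (x - a *: y).
have aj : Num.conj a = Num.conj (inner x y) / `|y| ^+ 2.
  rewrite rmorphM /= fmorphV rmorphXn /=.
  by congr (_ / _ ^+ 2); exact: (geC0_conj (normr_ge0 y)).
rewrite innerBl !innerBr !innerZl !innerZr -!inner_norm (innerC y x).
rewrite aj /a divfK ?expf_neq0 ?gt_eqF// subrr subr0.
by rewrite mulrAC [X in X / _]mulrC -normCK subr_ge0 ler_pdivrMr ?exprn_gt0.
Qed.

Lemma rnorm_inner_le x y : rnorm (inner x y) <= rnorm x * rnorm y.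
Proof.
by rewrite -lecR rmorphM /= !rnormE inner_cauchy_schwarz.
Qed.

Lemma inner_rnorm x : inner x x = (rnorm x ^+ 2)%:C.
Proof. by rewrite rmorphXn /= rnormE inner_norm. Qed.

Lemma inner_cvgl (u : nat -> H) x y :
  u @ \oo --> x -> (fun n => inner (u n) y) @ \oo --> inner x y.
Proof.
move=> /cvgrPdist_lt ux; apply/cvgrPdist_lt => e e0.
(* The summand 1 covers the case [y = 0]. *)
have e'0 : 0 < e / (1 + `|y|) by rewrite divr_gt0// ltr_wpDr.
near=> n.
rewrite -innerBl (le_lt_trans (inner_cauchy_schwarz _ _))//.
have y1 : `|y| < 1 + `|y| by rewrite ltrDr.
rewrite (@le_lt_trans _ _ (`|x - u n| * (1 + `|y|)))//.
  by rewrite ler_wpM2l// ltW.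
rewrite -ltr_pdivlMr; last by rewrite ltr_wpDr.
by near: n; apply: ux.
Unshelve. all: by end_near. Qed.

End InnerProduct.

Lemma complex_cvg_unique (R : realType) (u : nat -> R[i]) (a b : R[i]) :
  u @ \oo --> a -> u @ \oo --> b -> a = b.
Proof. exact/cvg_unique/norm_hausdorff. Qed.

(** * Bessel inequality, orthonormal expansion and Parseval identity *)

Section Parseval.
Variables (R : realType) (H : hilbertType R).
Implicit Types (e : nat -> H) (x y : H).

Lemma inner_orthogonal_sum (I : eqType) (r : seq I) (c : I -> R[i])
    (e : I -> H) :
  uniq r -> {in r &, forall i j, i <> j -> inner (e i) (e j) = 0} ->
  inner (\sum_(i <- r) c i *: e i) (\sum_(i <- r) c i *: e i) =
  \sum_(i <- r) `|c i| ^+ 2 * inner (e i) (e i).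
Proof.
move=> ur oe; rewrite inner_suml big_seq [RHS]big_seq; apply: eq_bigr => i ir.
rewrite inner_sumr (bigD1_seq i)//= big_seq_cond big1 ?addr0.
  by rewrite innerZl innerZr mulrA normCK.
move=> j /andP[jr /eqP ji].
by rewrite innerZl innerZr oe ?mulr0//; exact: nesym.
Qed.

Section Basis.
Variable e : nat -> H.
Hypothesis e01 : forall i, e i = 0 \/ rnorm (e i) = 1.
Hypothesis oe : forall i j, i <> j -> inner (e i) (e j) = 0.

(** A zero basis vector has a zero coefficient and a nonzero one has norm 1, so the factor
    [inner (e i) (e i)] left by Pythagoras drops out. *)
Lemma inner_coefM x i : `|inner x (e i)| ^+ 2 * inner (e i) (e i) =
  (rnorm (inner x (e i)) ^+ 2)%:C.
Proof.
rewrite rmorphXn /= rnormE; case: (e01 i) => [->|ei1].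
  by rewrite inner0r normr0 expr0n mul0r.
by rewrite inner_rnorm ei1 expr1n mulr1.
Qed.

Lemma inner_partial_sum x m n :
  inner (\sum_(m <= i < n) inner x (e i) *: e i)
        (\sum_(m <= i < n) inner x (e i) *: e i) =
  (\sum_(m <= i < n) rnorm (inner x (e i)) ^+ 2)%:C.
Proof.
rewrite inner_orthogonal_sum ?iota_uniq//; last by move=> i j _ _; exact: oe.
by rewrite raddf_sum; apply: eq_bigr => i _; exact: inner_coefM.
Qed.

(** For the partial sum [p], both [inner p x] and [inner p p] equal the sum of squares [s], so the
    squared norm of [x - p] is that of [x] minus [s]. *)
Lemma bessel x n :
  \sum_(0 <= i < n) rnorm (inner x (e i)) ^+ 2 <= rnorm x ^+ 2.
Proof.
set p := \sum_(0 <= i < n) inner x (e i) *: e i.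
set s := \sum_(0 <= i < n) _.
have px : inner p x = s%:C.
  rewrite /p inner_suml raddf_sum; apply: eq_bigr => i _ /=.
  by rewrite innerZl (innerC (e i)) -normCK rmorphXn/= rnormE.
have := inner_ge0 (x - p).
rewrite innerBl !innerBr [inner x p]innerC px inner_partial_sum -/s inner_rnorm.
by rewrite subrr subr0 (geC0_conj _) ?ler0c ?sumr_ge0// => [|i _];
  rewrite ?sqr_ge0// -rmorphB ler0c subr_ge0.
Qed.

(** By Pythagoras the squared norm of a block of this series is the same block of the series of
    squared coefficients, which converges by Bessel. *)
Lemma coef_sum_cauchy x : cauchy (series (fun i => inner x (e i) *: e i) @ \oo).
Proof.
have : cvgn (series (fun i => rnorm (inner x (e i)) ^+ 2)).
  apply: nondecreasing_is_cvgn.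
    by apply: nondecreasing_series => i _ _; exact: sqr_ge0.
  exists (rnorm x ^+ 2) => _ [n _ <-]; exact: bessel.
move=> /cauchy_cvgP/cauchy_seriesP h.
apply/cauchy_seriesP => z z0.
(* The tolerance [z] lives in [R[i]]; being positive, it is real. *)
have zE : (complex.Re z)%:C = z by rewrite RRe_real// ger0_real// ltW.
have r0 : 0 < complex.Re z by rewrite -ltcR zE.
have := h _ (exprn_gt0 2 r0); apply: filterS => -[m n] /= hmn.
rewrite -(@ltr_pXn2r _ 2) ?nnegrE// ?ltW// inner_norm inner_partial_sum.
rewrite -zE -rmorphXn ltcR.
by rewrite (le_lt_trans _ hmn)// ler_norm.
Qed.

Hypothesis te : forall x, (forall i, inner x (e i) = 0) -> x = 0.

(** Completeness gives a limit. Pairing with [e i] is continuous and constant along the partial sums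
    past [i], so [x] minus the limit is orthogonal to every [e i], hence zero. *)
Lemma basis_expansion x : series (fun i => inner x (e i) *: e i) @ \oo --> x.
Proof.
have /cauchy_cvg := coef_sum_cauchy x.
set u := series _ => /= cu.
suff <- : lim (u @ \oo) = x by [].
apply/eqP; rewrite eq_sym -subr_eq0; apply/eqP/te => i.
rewrite innerBl; apply/eqP; rewrite subr_eq0; apply/eqP.
apply: esym; apply: (complex_cvg_unique (inner_cvgl (y := e i) cu)).
apply: cvg_near_cst; near=> n.
have ni : (i < n)%N by near: n; exists i.+1.
rewrite /u /series/= inner_suml (bigD1_seq i) ?iota_uniq ?mem_index_iota//=.
rewrite big1_seq => [|j /andP[/eqP ji _]]; last by rewrite innerZl oe ?mulr0.
rewrite innerZl addr0; case: (e01 i) => [->|ei1].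
  by rewrite !inner0r mulr0.
by rewrite inner_rnorm ei1 expr1n mulr1.
Unshelve. all: by end_near. Qed.

End Basis.

(** The expansion of [x] is paired with [y] term by term. The terms are the diagonal coefficients of
    the operator [inner v y *: x], whose trace is needed later. *)
Lemma parseval e x y : orthonormal_basis e ->
  (fun n => \sum_(k < n) inner (e k) y * inner x (e k)) @ \oo --> inner x y.
Proof.
move=> [e01 oe te].
have := inner_cvgl (y := y) (basis_expansion e01 oe te (x := x)).
apply: cvg_trans; apply: near_eq_cvg; near=> n.
rewrite /series /= inner_suml big_mkord; apply: eq_bigr => i _.
by rewrite innerZl mulrC.
Unshelve. all: by end_near. Qed.

End Parseval.

(** * Gram-Schmidt and the existence of an orthonormal basis *)

Section GramSchmidt.
Variables (R : realType) (H : hilbertType R).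
Variable d : nat -> H.

(* The inverse of 0 being 0, a vector in the span of the previous ones yields a
   zero term, as [orthonormal_basis] allows. *)
Definition gs_residue (s : seq H) x : H := x - \sum_(v <- s) inner x v *: v.

Definition gs_step (s : seq H) x : H :=
  `|gs_residue s x|^-1 *: gs_residue s x.

Fixpoint gs_prefix n : seq H :=
  if n is m.+1 then rcons (gs_prefix m) (gs_step (gs_prefix m) (d m)) else [::].

Definition gram_schmidt n : H := gs_step (gs_prefix n) (d n).

Lemma gs_prefixE n : gs_prefix n = mkseq gram_schmidt n.
Proof. by elim: n => //= n IHn; rewrite mkseqS -IHn. Qed.

Lemma gram_schmidt01 n : gram_schmidt n = 0 \/ rnorm (gram_schmidt n) = 1.
Proof.
rewrite /gram_schmidt /gs_step; set r := gs_residue _ _.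
have [->|r0] := eqVneq r 0; [left|right]; first by rewrite scaler0.
apply: complexI; rewrite rnormE normrZ normfV normr_id mulVf ?normr_eq0//.
Qed.

Lemma gram_schmidt_sum n :
  \sum_(v <- gs_prefix n) inner (d n) v *: v =
  \sum_(0 <= i < n) inner (d n) (gram_schmidt i) *: gram_schmidt i.
Proof. by rewrite gs_prefixE big_map /index_iota subn0. Qed.

(** By strong induction on [j], only the term of index [i] of the subtracted sum survives the
    pairing, and it cancels [inner (d j) (gram_schmidt i)]. *)
Lemma gram_schmidt_orthogonal_lt j i : (i < j)%N ->
  inner (gram_schmidt j) (gram_schmidt i) = 0.
Proof.
elim/ltn_ind: j i => j IHj i ij.
rewrite {1}/gram_schmidt /gs_step innerZl; move: `|_|^-1 => c.
rewrite /gs_residue gram_schmidt_sum.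
rewrite innerBl inner_suml (bigD1_seq i) ?iota_uniq ?mem_index_iota//=.
rewrite big1_seq => [|k /andP[ki]]; last first.
  rewrite mem_index_iota => /= kj. rewrite innerZl.
  (* The induction hypothesis is used at [k] if [i < k], and at [i], after conjugation, if
     [k < i]. *)
  have [ik|ki'] := ltnP i k; first by rewrite IHj ?mulr0.
  rewrite (innerC (gram_schmidt k)) IHj ?rmorph0 ?mulr0//.
  by rewrite ltn_neqAle; apply/andP.
rewrite addr0 innerZl; case: (gram_schmidt01 i) => [->|i1].
  by rewrite !inner0r mulr0 subr0 mulr0.
by rewrite (inner_rnorm (gram_schmidt i)) i1 expr1n mulr1 subrr mulr0.
Qed.

Lemma gram_schmidt_orthogonal i j : i <> j ->
  inner (gram_schmidt i) (gram_schmidt j) = 0.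
Proof.
move=> /eqP; case: ltngtP => // ij _; last exact: gram_schmidt_orthogonal_lt.
by rewrite innerC gram_schmidt_orthogonal_lt ?rmorph0.
Qed.

(** Each [d n] is a combination of the [gram_schmidt i] with [i <= n], also when its residue
    vanishes. *)
Lemma gram_schmidt_span x : (forall i, inner x (gram_schmidt i) = 0) ->
  forall n, inner x (d n) = 0.
Proof.
move=> xe n.
have -> : d n = `|gs_residue (gs_prefix n) (d n)| *: gram_schmidt n +
    \sum_(0 <= i < n) inner (d n) (gram_schmidt i) *: gram_schmidt i.
  rewrite -gram_schmidt_sum; apply/eqP; rewrite -subr_eq -/(gs_residue _ _).
  rewrite /gram_schmidt /gs_step scalerA; set r := gs_residue _ _.
  have [->|r0] := eqVneq r 0; first by rewrite scaler0.
  by rewrite divff ?normr_eq0// scale1r.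
rewrite innerC innerDl innerZl (innerC (gram_schmidt n)) xe rmorph0 mulr0 add0r.
rewrite inner_suml big1 ?rmorph0// => i _.
by rewrite innerZl (innerC (gram_schmidt i)) xe rmorph0 mulr0.
Qed.

End GramSchmidt.

(** If [x] were nonzero, some [y] in [D] would be closer to [x] than 0 is; but
    [inner x x = inner x (x - y)], against Cauchy-Schwarz. *)
Lemma dense_orthogonal_eq0 (R : realType) (H : hilbertType R) (D : set H) x :
  dense D -> (forall y, D y -> inner x y = 0) -> x = 0.
Proof.
move=> dD xD; apply/eqP/negP => /negP x0.
have nx0 : 0 < `|x| by rewrite normr_gt0.
have [||y [/= xy Dy]] := dD (ball x `|x|).
- by exists x; exact: ballxx.
- exact: ball_open.
have := inner_cauchy_schwarz x (x - y).
rewrite innerBr (xD y Dy) subr0 ger0_norm ?inner_ge0// -inner_norm expr2.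
rewrite ler_pM2l// => /(lt_le_trans _) lt_x; have := lt_x `|x - y|.
by move: xy; rewrite -ball_normE /= => xy /(_ xy); rewrite ltxx.
Qed.

(* Without a basis, [trace] would be the choice of an arbitrary number. *)
Lemma separable_orthonormal_basis (R : realType) (H : hilbertType R) :
  separable_space H -> exists e : nat -> H, orthonormal_basis e.
Proof.
move=> [D /countable_injP[f finj] dD].
(* [d] lists [D] by inverting the injection [f]; numbers that are not values of [f] on [D] give 0,
   harmless in Gram-Schmidt. *)
pose d n := xget 0 [set x | D x /\ f x = n].
have df x : D x -> d (f x) = x.
  move=> Dx; rewrite /d; case: xgetP => [y -> [Dy fyx]|/(_ x)[]//].
  by apply: finj => //; rewrite inE.
exists (gram_schmidt d); split.
- exact: gram_schmidt01.
- exact: gram_schmidt_orthogonal.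
- move=> x xe; apply: (dense_orthogonal_eq0 dD) => y Dy.
  by rewrite -(df _ Dy); exact: gram_schmidt_span.
Qed.

(** * Traces and adjoints of rank-one and unitary operators *)

Section RankOne.
Variables (R : realType) (H : hilbertType R).
Implicit Types (a b x y : H) (T : H -> H).

Lemma trace_rank_one a b : separable_space H ->
  trace (fun v => inner v a *: b) = inner b a.
Proof.
move=> sepH; rewrite /trace.
have h e : orthonormal_basis e ->
  (fun n => \sum_(k < n) inner (inner (e k) a *: b) (e k)) @ \oo --> inner b a.
  move=> /parseval -/(_ b a); apply: cvg_trans; apply: near_eq_cvg; near=> n.
  by apply: eq_bigr => k _; rewrite innerZl.
(* By [h], [inner b a] is admissible; since separability provides a basis, uniqueness of limits
   makes it the only choice. *)
case: xgetP => [t -> /= ht|/(_ (inner b a))]; last by move=> /(_ h).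
have [e be] := separable_orthonormal_basis sepH.
exact: complex_cvg_unique (ht _ be) (h _ be).
Unshelve. all: by end_near. Qed.

(** [adjoint] is a choice, identified by uniqueness: the difference of two adjoints at [y] is
    orthogonal to itself. *)
Lemma adjointP T S : bounded_op S ->
  (forall x y, inner (T x) y = inner x (S y)) -> adjoint T = S.
Proof.
move=> bS TS; rewrite /adjoint.
case: xgetP => [S' -> [_ TS']|/(_ S)[]//].
apply/funext => y; apply/eqP; rewrite -subr_eq0; apply/eqP/inner_eq0.
by rewrite innerBr -TS' -TS subrr.
Qed.

Lemma rank_one_bounded a b : bounded_op (fun v => inner v a *: b).
Proof.
split; first by move=> c u v; rewrite innerDl innerZl scalerDl scalerA.
exists (rnorm a * rnorm b) => x.
rewrite rnormZ mulrAC ler_wpM2r ?rnorm_ge0// mulrC; exact: rnorm_inner_le.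
Qed.

Lemma adjoint_rank_one a b :
  adjoint (fun v => inner v a *: b) = (fun v => inner v b *: a).
Proof.
apply: adjointP; first exact: rank_one_bounded.
by move=> x y; rewrite innerZl innerZr [in RHS]mulrC -innerC.
Qed.

(** The adjoint is the right inverse [S] given by surjectivity: [inner (T x) y = inner (T x) (T (S
    y)) = inner x (S y)]. Injectivity of the isometry [T] makes [S] linear. *)
Lemma adjoint_unitary T : unitary_op T -> cancel (adjoint T) T.
Proof.
move=> [lT iT sT]; have /boolp.choice[S TS] := sT.
suff -> : adjoint T = S by [].
have nS v : rnorm (S v) = rnorm v.
  apply/eqP; rewrite -(@eqrXn2 _ 2) ?rnorm_ge0//; apply/eqP/complexI.
  by rewrite -!inner_rnorm -iT TS.
have TI u v : T u = T v -> u = v.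
  move=> uv; apply/eqP; rewrite -subr_eq0; apply/eqP/inner_eq0.
  by rewrite -iT addrC -scaleN1r lT uv scaleN1r addNr inner0l.
apply: adjointP; last by move=> x y; rewrite -[in LHS](TS y) iT.
split; first by move=> c u v; apply: TI; rewrite lT !TS.
by exists 1 => x; rewrite mul1r nS.
Qed.

(** As [inner (adjoint T v) a = inner v (T a)], the composite is again of rank one. *)
Lemma trace_rank_one_unitary T a b : separable_space H -> unitary_op T ->
  trace ((fun v => inner v a *: b) \o adjoint T) = inner b (T a).
Proof.
move=> sepH uT; have [_ iT _] := uT; rewrite -trace_rank_one//; congr trace.
by apply/funext => v /=; rewrite -iT adjoint_unitary.
Qed.

End RankOne.

(** * Compactness and singular values of rank-one operators *)

Section RankOneSchatten.
Variables (R : realType) (H : hilbertType R).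
Implicit Types (a b x y : H) (T : H -> H).

Lemma real_scale_continuous b : continuous (fun t : R => t%:C *: b).
Proof.
move=> t; apply/cvgrPdist_lt => e e0.
have b1 : 0 < 1 + rnorm b by rewrite ltr_wpDr ?rnorm_ge0.
have eE : (complex.Re e)%:C = e by rewrite RRe_real// ger0_real// ltW.
have r0 : 0 < complex.Re e by rewrite -ltcR eE.
near=> u.
have -> : `|t%:C *: b - u%:C *: b| = (`|t - u| * rnorm b)%:C.
  rewrite -scalerBl -rmorphB normrZ rmorphM /= rnormE; congr (_ * _).
  by rewrite [LHS]normc_def /= expr0n addr0 sqrtr_sqr.
rewrite -eE ltcR.
have bb : rnorm b <= 1 + rnorm b by rewrite lerDr.
rewrite (le_lt_trans (ler_wpM2l _ bb))// -ltr_pdivlMr//.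
near: u.
apply: (@cvgr_dist_lt _ R^o); last by rewrite divr_gt0.
exact: cvg_id.
Unshelve. all: by end_near. Qed.

Lemma complex_scale_continuous b :
  continuous (fun p : R * R => (p.1 +i* p.2) *: b).
Proof.
have -> : (fun p : R * R => (p.1 +i* p.2) *: b) =
    (fun p => p.1%:C *: b + p.2%:C *: ('i%C *: b)).
  apply/funext => p; rewrite scalerA -scalerDl; congr (_ *: _).
  by rewrite [LHS]complexE /= mulrC.
move=> p; apply: cvgD.
  apply: (@cvg_comp _ _ _ fst (fun t : R => t%:C *: b)); first exact: cvg_fst.
  exact: real_scale_continuous.
apply: (@cvg_comp _ _ _ snd (fun t : R => t%:C *: ('i%C *: b))).
  exact: cvg_snd.
exact: real_scale_continuous.
Qed.

(** On the unit ball the coefficient [inner v a] stays in a square of the complex plane, so the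
    image lies in the compact set [K]. *)
Lemma rank_one_compact a b : compact_op (fun v => inner v a *: b).
Proof.
split; first exact: rank_one_bounded.
pose I : set R := [set` `[- rnorm a, rnorm a]].
pose K : set H := (fun p : R * R => (p.1 +i* p.2) *: b) @` (I `*` I).
have cK : compact K.
  apply: continuous_compact.
    exact/continuous_subspaceT/complex_scale_continuous.
  by apply: compact_setX; exact: segment_compact.
apply: precompact_subset (compact_precompact _ cK); last exact: norm_hausdorff.
move=> _ [v /= v1 <-].
have h : rnorm (inner v a) <= rnorm a.
  by rewrite (le_trans (rnorm_inner_le _ _))// ler_piMl// rnorm_ge0.
exists (complex.Re (inner v a), complex.Im (inner v a)).
  2: by case: (inner v a).
by split; rewrite /I/= in_itv /= -ler_norml (le_trans _ h)//;
  [exact: rnorm_ge_Re|exact: rnorm_ge_Im].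
Qed.

Lemma subspace_dim_ge0 (E : set H) : (0 <= subspace_dim E)%E.
Proof.
apply: ereal_sup_ubound; exists 0%N => //.
exists (fun _ => 0); split; first by case.
by move=> c _ [].
Qed.

Lemma subspace_dim_line (E : set H) c :
  (forall x, E x -> exists t : R[i], x = t *: c) -> (subspace_dim E <= 1)%E.
Proof.
move=> Ec; apply: ge_ereal_sup => _ [n [v [vE vfree]] <-].
rewrite lee_fin (_ : 1 = 1%:R)// ler_nat leqNgt; apply/negP => n1.
pose i0 := Ordinal (ltnW n1); pose i1 := Ordinal n1.
have [t0 v0] := Ec _ (vE i0); have [t1 v1] := Ec _ (vE i1).
have i10 : i1 != i0 by [].
(* Independence is applied to the relation [t1 *: v i0 - t0 *: v i1 = 0]; then [v i0 = 0], which
   contradicts independence again. *)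
have t00 : t0 = 0.
  have := vfree (fun i => if i == i0 then t1 else if i == i1 then - t0 else 0).
  rewrite (bigD1 i0)// (bigD1 i1)//= big1 => [|i /andP[/negPf -> /negPf ->]].
    rewrite ?eqxx v0 v1 !scalerA addr0 -scalerDl mulrC mulNr subrr scale0r.
    by move=> /(_ erefl i1)/eqP; rewrite ?eqxx /= oppr_eq0 => /eqP.
  by rewrite scale0r.
have := vfree (fun i => (i == i0)%:R).
rewrite (bigD1 i0)//= big1 => [|i /negPf ->]; last by rewrite scale0r.
rewrite v0 t00 scale0r scaler0 addr0 => /(_ erefl i0)/eqP.
by rewrite eqxx oner_eq0.
Qed.

Lemma subspace_dim_zero (E : set H) :
  (forall x, E x -> x = 0) -> subspace_dim E = 0%E.
Proof.
move=> E0; apply/eqP; rewrite eq_le subspace_dim_ge0 andbT.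
apply: ge_ereal_sup => _ [[|n] [v [vE vfree]] <-] //.
have := vfree (fun i => 1).
rewrite big1 => [|i _]; last by rewrite (E0 _ (vE i)) scaler0.
by move=> /(_ erefl ord0)/eqP; rewrite oner_eq0.
Qed.

(** The left side is a multiple of [a], hence so is [x]. Pairing with [a] and cancelling [inner x a]
    determines [s]; if [inner x a = 0], then [x = 0]. *)
Lemma rank_one_singular_vector a b (s : R) x : 0 < s ->
  adjoint (fun v => inner v a *: b) (inner x a *: b) = (s ^+ 2)%:C *: x ->
  x = ((s ^+ 2)%:C^-1 * (inner x a * inner b b)) *: a /\
  (s = rnorm a * rnorm b \/ x = 0).
Proof.
move=> s0; rewrite adjoint_rank_one innerZl => sx.
have s2 : (s ^+ 2)%:C != 0 :> R[i].
  by rewrite (inj_eq (@complexI _) _ 0) expf_neq0// gt_eqF.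
have xE : x = ((s ^+ 2)%:C^-1 * (inner x a * inner b b)) *: a.
  by rewrite -scalerA sx scalerA mulVf// scale1r.
split=> //.
have [xa|xa] := eqVneq (inner x a) 0.
  by right; rewrite xE xa mul0r mulr0 scale0r.
left; apply/eqP; rewrite -(@eqrXn2 _ 2) ?mulr_ge0 ?rnorm_ge0 ?(ltW s0)//.
apply/eqP/complexI.
have := congr1 (inner^~ a) xE; rewrite innerZl !inner_rnorm.
move: (inner x a) xa s2 => c c0 s2 cE.
apply: (mulfI c0); rewrite [in LHS]cE exprMn rmorphM /=.
field.
by rewrite fmorph_eq0 gt_eqF.
Qed.

Lemma sing_mult_rank_one_le1 a b (s : R) : 0 < s ->
  (sing_mult (fun v => inner v a *: b) s <= 1)%E.
Proof.
move=> s0; apply: (@subspace_dim_line _ a) => x /(rank_one_singular_vector s0).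
by move=> [xE _]; eexists; exact: xE.
Qed.

Lemma sing_mult_rank_one_eq0 a b (s : R) : 0 < s -> s <> rnorm a * rnorm b ->
  sing_mult (fun v => inner v a *: b) s = 0%E.
Proof.
move=> s0 sab; apply: subspace_dim_zero => x /(rank_one_singular_vector s0).
by move=> [_ []].
Qed.

(** Only [s0] can be a singular value, with multiplicity at most one, so at most one finite term
    remains. The trace formula for [F] needs [p = 1], Plancherel [p = 2]. *)
Lemma rank_one_schatten p a b : schatten p (fun v => inner v a *: b).
Proof.
split; first exact: rank_one_compact.
apply: poweR_lty.
pose s0 := rnorm a * rnorm b.
pose f s := (sing_mult (fun v => inner v a *: b) s * (s `^ p)%R%:E)%E.
rewrite -[X in (X < _)%E]/(\esum_(s in [set s : R | (0 < s)%R]) f s)%E.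
have f0 s : 0 < s -> s \notin [set s0] -> f s = 0%E.
  by move=> sp /negP ss0; rewrite /f sing_mult_rank_one_eq0 ?mul0e// => e;
    apply: ss0; rewrite inE.
rewrite (eq_esum (b := fun s => if s \in [set s0] then f s else 0%E)).
  2: by move=> s sp; case: ifPn => // /f0 ->.
rewrite -esum_mkcondr esum_mkcondl esum_set1.
  case: ifPn => [|_]; last exact: ltry.
  rewrite inE /= => sp; rewrite /f.
  rewrite (@le_lt_trans _ _ (1 * (s0 `^ p)%:E)%E)//; last by rewrite mul1e ltry.
  by rewrite lee_wpmul2r ?lee_fin ?powR_ge0//; exact: sing_mult_rank_one_le1.
case: ifPn => // _.
by rewrite mule_ge0 ?subspace_dim_ge0// lee_fin powR_ge0.
Qed.

End RankOneSchatten.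

(** * Integral inequalities *)

Section ComplexIntegral.
Context d (X : measurableType d) (R : realType).
Variable mu : {measure set X -> \bar R}.
Implicit Types f g : X -> R[i].

Lemma measurable_rnorm f : cmeasurable f ->
  measurable_fun setT (fun x => rnorm (f x)).
Proof.
move=> [mr mi].
rewrite (_ : (fun x => _) = (fun x =>
  (complex.Re (f x) ^+ 2 + complex.Im (f x) ^+ 2) `^ 2^-1)); last first.
  by apply/funext => x; rewrite rnorm_complexE powR12_sqrt// addr_ge0 ?sqr_ge0.
apply: (measurableT_comp (measurable_powR _)).
by apply: measurable_funD; exact: measurable_funX.
Qed.

(** The real part of the integrand is at most [c] times the norm of [f] almost everywhere. *)
Lemma Re_L2_inner_le f g (c : R) : cmeasurable f -> cmeasurable g -> 0 <= c ->
  {ae mu, forall x, rnorm (g x) <= c} ->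
  (\int[mu]_x (rnorm (f x))%:E < +oo)%E ->
  ((complex.Re (L2_inner mu f g))%:E <= c%:E * \int[mu]_x (rnorm (f x))%:E)%E.
Proof.
move=> mf mg c0 gc fi.
set I := (\int[mu]_x _)%E.
pose h x := complex.Re (f x * (g x)^*%C).
have hE x : h x =
    complex.Re (f x) * complex.Re (g x) + complex.Im (f x) * complex.Im (g x).
  by rewrite /h; case: (f x) => ? ?; case: (g x) => ? ? /=; rewrite mulrN opprK.
have mh : measurable_fun setT h.
  rewrite (funext hE); move: mf mg => [? ?] [? ?].
  by apply: measurable_funD; exact: measurable_funM.
have hI : (`|\int[mu]_x (h x)%:E| <= c%:E * I)%E.
  apply: (le_trans (le_abse_integral _ _ _)) => //.
    exact/measurable_EFinP.
  rewrite -ge0_integralZl//; last by move=> x _; rewrite lee_fin rnorm_ge0.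
    2: exact/measurable_EFinP/measurable_rnorm.
  apply: ae_ge0_le_integral => //.
  - by apply: measurableT_comp => //; exact/measurable_EFinP.
  - by move=> x _; rewrite -EFinM lee_fin mulr_ge0 ?rnorm_ge0.
  - under eq_fun do rewrite -EFinM.
    apply/measurable_EFinP; apply: measurable_funM => //.
    exact: measurable_rnorm.
  - apply: filterS gc => x gxc _.
    rewrite -EFinM lee_fin (le_trans (rnorm_ge_Re _))//.
    rewrite -lecR rnormE normrM normcJ -!rnormE -rmorphM lecR mulrC.
    by rewrite ler_wpM2r// rnorm_ge0.
have I0 : (0 <= I)%E by apply: integral_ge0 => x _; rewrite lee_fin rnorm_ge0.
(* [cintegral] is built on real-valued integrals, where [fine] would turn an infinite value into 0;
   finiteness excludes this. *)
have hfin : (\int[mu]_x (h x)%:E)%E \is a fin_num.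
  rewrite fin_num_abs (le_lt_trans hI)// lte_mul_pinfty//.
rewrite /L2_inner /cintegral /= /Rintegral fineK//.
by rewrite (le_trans _ hI)// lee_abs.
Qed.

(** Hölder with both exponents 2, for the factors [w x]^ (- s / 2)[and]w x
    [^ (s / 2) * rnorm (f x)]. *)
Lemma weighted_cauchy_schwarz f (w : X -> R) (s : R) : cmeasurable f ->
  measurable_fun setT w -> (forall x, 0 < w x) ->
  (\int[mu]_x (rnorm (f x))%:E <=
    'N[mu]_2%:E[EFin \o (fun x => (w x `^ (- s / 2))%R)] *
    (\int[mu]_x (w x `^ s * rnorm (f x) ^+ 2)%R%:E) `^ 2^-1)%E.
Proof.
move=> mf mw w0.
pose g x := w x `^ (s / 2) * rnorm (f x).
have mg : measurable_fun setT g.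
  apply: measurable_funM; last exact: measurable_rnorm.
  by apply: (measurableT_comp (measurable_powR _)).
have mv : measurable_fun setT (fun x => w x `^ (- s / 2)).
  by apply: (measurableT_comp (measurable_powR _)).
have h2 : 2^-1 + 2^-1 = 1 :> R by rewrite [RHS]splitr !mul1r.
have := hoelder mu mv mg (ltr0n _ 2) (ltr0n _ 2) h2.
rewrite Lnorm1; congr (_ <= _ * _)%E.
  apply: eq_integral => x _ /=; congr EFin.
  rewrite mulNr powRN mulKf ?gt_eqF ?powR_gt0//.
  by rewrite ger0_norm// rnorm_ge0.
rewrite unlock; congr (_ `^ _)%E; apply: eq_integral => x _ /=.
rewrite powR_mulrn// real_normK ?num_real//; congr EFin.
by rewrite /g exprMn -powR_mulrn ?powR_ge0// -powRrM divfK.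
Qed.

End ComplexIntegral.

(** * Operator bounds from the integral of the Fourier transform *)

Section FourierBound.
Variables (R : realType) (G : topologicalZmodType) (H : hilbertType R).
Variables (U : G -> H -> H) (sigmaV : dual R G -> G).
Variables (mu : {measure set (borel (dual R G)) -> \bar R}).
Variables (F : (H -> H) -> borel (dual R G) -> R[i]).
Hypothesis sepH : separable_space H.
Hypothesis uU : forall x, unitary_op (U x).
Hypothesis fF : quantum_fourier mu U sigmaV F.

(** Almost everywhere the transform is [inner b (U (sigmaV xi) a)]; Cauchy-Schwarz and the isometry
    of [U] bound it. *)
Lemma fourier_rank_one_le (a b : H) :
  {ae mu, forall xi,
    rnorm (F (fun v => inner v a *: b) xi) <= rnorm a * rnorm b}.
Proof.
have [_ _ _ _ F1] := fF.
apply: filterS (F1 _ (rank_one_schatten 1 a b)) => xi ->.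
rewrite /fourier_S1 trace_rank_one_unitary//.
rewrite (le_trans (rnorm_inner_le _ _))// mulrC ler_wpM2r ?rnorm_ge0//.
rewrite -(@ler_pXn2r _ 2) ?nnegrE ?rnorm_ge0// -lecR -!inner_rnorm.
by have [_ -> _] := uU (sigmaV xi).
Qed.

(** Composing [T] with the adjoint gives the rank-one operator [inner v b *: T a]. *)
Lemma hs_inner_rank_one T (a b : H) : linear T ->
  hs_inner T (fun v => inner v a *: b) = inner (T a) b.
Proof.
move=> lT; rewrite /hs_inner adjoint_rank_one -trace_rank_one//; congr trace.
apply/funext => v /=.
have T0 : T 0 = 0.
  by have := lT (-1) 0 0; rewrite scaler0 addr0 scaleN1r addNr.
by have := lT (inner v b) a 0; rewrite T0 !addr0.
Qed.

Lemma rnorm_le_fourier_L1 T x : schatten 2 T ->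
  (\int[mu]_xi (rnorm (F T xi))%:E < +oo)%E ->
  ((rnorm (T x))%:E <= (rnorm x)%:E * \int[mu]_xi (rnorm (F T xi))%:E)%E.
Proof.
move=> sT iT; have [F2 _ Fi _ _] := fF.
have [->|Tx0] := eqVneq (rnorm (T x)) 0.
  rewrite mule_ge0 ?lee_fin ?rnorm_ge0//.
  by apply: integral_ge0 => xi _; rewrite lee_fin rnorm_ge0.
have sS := rank_one_schatten 2 x (T x).
have [[[lT _] _] _] := sT.
have [mT _] := F2 _ sT; have [mS _] := F2 _ sS.
have := Re_L2_inner_le mT mS _ (fourier_rank_one_le x (T x)) iT.
rewrite mulr_ge0 ?rnorm_ge0// => /(_ isT).
(* Plancherel makes the left side the square of [rnorm (T x)]; one factor, nonzero here, cancels
   against the right side. *)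
rewrite Fi// hs_inner_rank_one// inner_rnorm /= expr2 !EFinM.
rewrite [in X in (_ <= X)%E](muleC (rnorm x)%:E) -muleA lee_pmul2l//.
by rewrite lte_fin lt_def Tx0 rnorm_ge0.
Qed.

End FourierBound.

(** * The Sobolev embedding into the bounded operators *)

Theorem theorem3p6 (R : realType) (G : topologicalZmodType)
    (H : hilbertType R)
    (G_locally_compact : locally_compact [set: G])
    (G_hausdorff : hausdorff_space G)
    (H_separable : separable_space H)
    (m : G -> G -> R[i]) (U : G -> H -> H)
    (U_projective : projective_rep m U)
    (U_irreducible : irreducible U)
    (sigma : G -> dual R G) (sigmaV : dual R G -> G)
    (m_heisenberg : heisenberg_multiplier m sigma sigmaV)
    (m_opp : forall x y, m x y = m (- x) (- y))
    (lambda : {measure set (borel G) -> \bar R})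
    (lambda_haar : haar_measure lambda)
    (U_square_integrable : square_integrable lambda U)
    (U_integrable : integrable_rep lambda U)
    (mu : {measure set (borel (dual R G)) -> \bar R})
    (mu_haar : haar_measure mu)
    (F : (H -> H) -> borel (dual R G) -> R[i])
    (F_fourier : quantum_fourier mu U sigmaV F)
    (s : R) (s_gt0 : 0 < s)
    (gamma : borel (dual R G) -> R)
    (gamma_measurable : measurable_fun setT gamma)
    (gamma_gt0 : forall xi, 0 < gamma xi)
    (weight_L2 : (fun xi => (1 + gamma xi ^+ 2) `^ (- s / 2)) \in Lfun mu 2%:E) :
  embeds (qsobolev mu F s gamma) (qsobolev_norm mu F s gamma)
         (@bounded_op R H) (@opnorm R H) /\
  forall T, qsobolev mu F s gamma T ->
    (opnorm T <=
      'N[mu]_2%:E[EFin \o (fun xi => (1 + gamma xi ^+ 2) `^ (- s / 2))%R] *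
      qsobolev_norm mu F s gamma T)%E.
Proof.
have [uU _ _ _ _] := U_projective.
set N := 'N[mu]_2%:E[_]%E.
have N0 : (0 <= N)%E by exact: Lnorm_ge0.
have Nfin : N \is a fin_num.
  rewrite ge0_fin_numE//.
  by move: weight_L2 => /andP[_]; rewrite inE.
have Q0 T : (0 <= qsobolev_norm mu F s gamma T)%E by exact: poweR_ge0.
have key T : qsobolev mu F s gamma T ->
    (opnorm T <= N * qsobolev_norm mu F s gamma T)%E.
  move=> [sT QT].
  have [/(_ _ sT)[mT _] _ _ _ _] := F_fourier.
  have w0 xi : 0 < 1 + gamma xi ^+ 2 by rewrite ltr_pwDl ?sqr_ge0.
  have mw : measurable_fun setT (fun xi => 1 + gamma xi ^+ 2).
    by apply: measurable_funD => //; exact: measurable_funX.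
  have I_le := weighted_cauchy_schwarz mu s mT mw w0.
  apply: ge_ereal_sup => _ [x x1 <-].
  apply: le_trans (I_le).
  apply: (le_trans (rnorm_le_fourier_L1 H_separable uU F_fourier _ sT _)).
    (* The transform is integrable because both factors of the weighted bound are finite. *)
    by rewrite (le_lt_trans I_le)// lte_mul_pinfty// ?poweR_lty.
  rewrite -[leRHS]mul1e lee_wpmul2r// ?lee_fin//.
  by apply: integral_ge0 => xi _; rewrite lee_fin rnorm_ge0.
split=> //; split; first by move=> T [[[bT _] _] _].
(* An embedding constant must be positive; adding 1 to the nonnegative [fine N] ensures it. *)
exists (fine N + 1); first by rewrite ltr_wpDl// fine_ge0.
move=> T sT; rewrite (le_trans (key _ sT))// lee_wpmul2r//.
by rewrite -[leLHS]fineK// lee_fin lerDl.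
Qed.
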